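(* For every integer $n\ge 4$, the type $B$ Tamari lattice $T_n^B$ satisfies $\lambda_2(T_n^B)=\lambda_1(T_n^B)-5$.
   Context: The type $B$ Tamari lattice $T_n^B$ is the finite partially ordered set whose elements are the $n$-tuples $(r_1,\dots,r_n)$ of symbols from $\{0,1,2,\dots,n-1,\infty\}$ satisfying the following two rules: (i) for all $1\le i<j\le n$, if $r_j-(j-i)$ is nonnegative, then $r_i\le r_j-(j-i)$; (ii) for all $1\le i\le n$, if $\infty>r_i\ge i$, then $r_{n+i-r_i}=\infty$. Here $\infty$ is larger than every integer and $\infty-m=\infty$ for every integer $m$ (so rule (i) imposes no restriction when $r_j=\infty$). The partial order is componentwise comparison: $(r_1,\dots,r_n)\le(s_1,\dots,s_n)$ if and only if $r_i\le s_i$ for all $i$. For a finite poset $P$, $\lambda(P)=(\lambda_1(P),\lambda_2(P),\dots)$ denotes the Greene–Kleitman partition of $P$: for each $k\ge1$, $\lambda_1(P)+\dots+\lambda_k(P)$ is the maximum number of elements in a union of $k$ chains in $P$. In particular, $\lambda_1(P)$ is the maximum number of elements in a chain of $P$, and $\lambda_1(P)+\lambda_2(P)$ is the maximum number of elements in a union of two chains of $P$. *)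

(* Defs.v *)
From HB Require Import structures.
From mathcomp Require Import all_boot all_order all_algebra.
Set Implicit Arguments.
Unset Strict Implicit.
Unset Printing Implicit Defensive.

Import Order.TTheory.

Section GreeneKleitman.
Variables (d : Order.disp_t) (P : finPOrderType d).
Implicit Types (C : {set P}) (k : nat).

Definition is_chain C : bool :=
  [forall x in C, forall y in C, (x >=< y)%O].

(* The k chains may overlap and may be empty. *)
Definition max_chain_union k : nat :=
  \max_(C : {ffun 'I_k -> {set P}} | [forall i, is_chain (C i)])
     #|\bigcup_(i < k) C i|.

(* Meaningful for k >= 1. The subtraction is never truncated, and the partial
   sums are the numbers max_chain_union k: see sum_greene_kleitman. *)
Definition greene_kleitman k : nat :=
  max_chain_union k - max_chain_union k.-1.

Lemma max_chain_union0 : max_chain_union 0 = 0.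
Proof.
apply/eqP; rewrite -leqn0; apply/bigmax_leqP => C _.
by rewrite big_ord0 cards0.
Qed.

Lemma max_chain_unionS k : max_chain_union k <= max_chain_union k.+1.
Proof.
apply/bigmax_leqP => C /forallP chC.
pose C' := [ffun i : 'I_k.+1 => oapp C set0 (unlift ord_max i)].
have chC' : [forall i, is_chain (C' i)].
  apply/forallP => i; rewrite ffunE; case: unliftP => [j _|_] /=; first exact: chC.
  by apply/forall_inP => x; rewrite inE.
apply: leq_trans (leq_bigmax_cond _ chC'); apply: subset_leq_card.
apply/bigcupsP => i _; apply: (bigcup_max (lift ord_max i)) => //.
by rewrite ffunE liftK.
Qed.

Lemma sum_greene_kleitman k :
  \sum_(1 <= i < k.+1) greene_kleitman i = max_chain_union k.
Proof.
elim: k => [|k IHk]; first by rewrite big_geq // max_chain_union0.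
by rewrite big_nat_recr //= IHk subnKC // max_chain_unionS.
Qed.

End GreeneKleitman.

Section TamariB.
Variable n : nat.

(* Some a is the integer a < n, and None is the symbol infinity. *)
Definition symbol := option 'I_n.

Definition le_symbol (x y : symbol) : bool :=
  match x, y with
  | _, None => true
  | None, Some _ => false
  | Some a, Some b => (a <= b)%N
  end.

(* Positions are 0-based: i : 'I_n stands for the position i.+1. *)
Definition tamariB_rule1 (r : {ffun 'I_n -> symbol}) : bool :=
  [forall i : 'I_n, forall j : 'I_n, (i < j)%N ==>
    if r j is Some b then
      (j - i <= b)%N ==> (if r i is Some a then (a <= b - (j - i))%N else false)
    else true].

Definition tamariB_rule2 (r : {ffun 'I_n -> symbol}) : bool :=
  [forall i : 'I_n,
    if r i is Some a then
      (i.+1 <= a)%N ==>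
        [forall j : 'I_n, (j.+1 == n + i.+1 - a)%N ==> (r j == None)]
    else true].

Record tamariB : predArgType := TamariB {
  tamariB_val :> {ffun 'I_n -> symbol};
  _ : tamariB_rule1 tamariB_val && tamariB_rule2 tamariB_val
}.

HB.instance Definition _ := [isSub for tamariB_val].
HB.instance Definition _ := [Finite of tamariB by <:].

Definition le_tamariB (r s : tamariB) : bool :=
  [forall i, le_symbol (r i) (s i)].

Fact le_tamariB_refl : reflexive le_tamariB.
Proof. by move=> r; apply/forallP => i; case: (r i) => /=. Qed.

Fact le_tamariB_anti : antisymmetric le_tamariB.
Proof.
move=> r s /andP[/forallP rs /forallP sr]; apply/val_inj/ffunP => i /=.
move: (rs i) (sr i); case: (r i) => [a|]; case: (s i) => [b|] //= ab ba.
by congr Some; apply/val_inj/eqP; rewrite /= eqn_leq ab.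
Qed.

Fact le_tamariB_trans : transitive le_tamariB.
Proof.
move=> s r t /forallP rs /forallP st; apply/forallP => i.
move: (rs i) (st i); case: (r i) => [a|]; case: (s i) => [b|] //;
  case: (t i) => [c|] //=; exact: leq_trans.
Qed.

Fact tamariB_display : Order.disp_t. Proof. exact: Order.Disp tt tt. Qed.

HB.instance Definition _ := Order.Le_isPOrder.Build tamariB_display tamariB
  le_tamariB_refl le_tamariB_anti le_tamariB_trans.

End TamariB.

(* Main.v *)
(* Reading infinity as n, the sum of the coordinates is a strictly increasing
   rank with values in [0, n^2], so chains have at most n^2 + 1 elements; filling
   the coordinates one after the other from the right attains this bound.

   The ranks 0, n^2 - 2, n^2 - 1 and n^2 are attained only once, so a union of
   two chains has at most 2 (n^2 + 1) - 4 elements. Equality would force both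
   chains through every rank in [1, n^2 - 3], with different elements at rank 1;
   but a chain meeting all these ranks must start with (0, ..., 0, 1). Hence the
   maximum is at most 2 n^2 - 3. It is attained by adding to the first chain a
   disjoint one through the ranks 1, 3, 4, ..., n^2 - 3, whose elements have two
   adjacent coordinates being filled at the same time. *)
Require Import Defs.
From mathcomp Require Import all_boot all_order all_algebra.
From mathcomp Require Import zify.

Set Implicit Arguments.
Unset Strict Implicit.
Unset Printing Implicit Defensive.

Import Order.TTheory.

(** * Rank function and the size of a chain *)

Section Values.
Variable n : nat.
Implicit Types (r s : tamariB n) (i j : 'I_n).

Definition value r i : nat := oapp val n (r i).

Definition rank r : nat := \sum_i value r i.

Lemma value_le r i : value r i <= n.
Proof. by rewrite /value; case: (r i) => [a|] //=; apply: ltnW. Qed.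

(** A finite symbol is less than [n], so reading infinity as [n] loses nothing. *)
Lemma value_inj r s : value r =1 value s -> r = s.
Proof.
move=> rs; apply/val_inj/ffunP => i; move: (rs i); rewrite /value.
case: (val r i) => [a|]; case: (val s i) => [b|] //= e.
- by congr Some; apply: val_inj.
- by have := ltn_ord a; rewrite e ltnn.
- by have := ltn_ord b; rewrite -e ltnn.
Qed.

Lemma le_value r s : (r <= s)%O = [forall i, value r i <= value s i].
Proof.
apply: eq_forallb => i; rewrite /value.
case: (val r i) => [a|]; case: (val s i) => [b|] //=; rewrite ?leqnn //.
  by rewrite ltnW.
by rewrite leqNgt ltn_ord.
Qed.

Lemma value_rule1 r i j : i < j -> value r j < n -> j - i <= value r j ->
  value r i <= value r j - (j - i).
Proof.
case: r => r0 P; have /andP[/forallP R1 _] := P; rewrite /value /= => ij.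
move: (R1 i) => /forallP/(_ j); rewrite ij /=.
case: (r0 j) => [b|] /=; last by rewrite ltnn.
by move=> + _ jb; rewrite jb; case: (r0 i).
Qed.

(** No coordinate decreases from [r] to [s], so one coordinate gains at most what the rank gains. *)
Lemma rank_step r s i :
  (r <= s)%O -> value s i + rank r <= value r i + rank s.
Proof.
rewrite le_value => /forallP rs; rewrite /rank.
rewrite (bigD1 i) //= [in leqRHS](bigD1 i) //=.
by rewrite addnCA leq_add2l leq_add2l leq_sum.
Qed.

Lemma rank_le r s : (r <= s)%O -> rank r <= rank s.
Proof. by rewrite le_value => /forallP rs; apply: leq_sum. Qed.

Lemma rank_inj_le r s : (r <= s)%O -> rank r = rank s -> r = s.
Proof.
move=> rs e; apply: value_inj => i; apply/eqP; rewrite eqn_leq.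
have := rank_step i rs; rewrite e leq_add2r => ->.
by move: rs; rewrite le_value => /forallP ->.
Qed.

Lemma rank_inj_off r s i :
  (forall j, j != i -> value r j = value s j) -> rank r = rank s -> r = s.
Proof.
move=> rs e; apply: value_inj => j; have [->|/rs //] := eqVneq j i.
move: e; rewrite /rank (bigD1 i) //= [RHS](bigD1 i) //=.
by rewrite (eq_bigr (value s)) => [/addIn|].
Qed.

(** [n * n] is the sum of [n] over all positions, so the rank loses every shortfall of a
    coordinate. *)
Lemma rank_deficit1 r i : rank r + (n - value r i) <= n * n.
Proof.
rewrite /rank (bigD1 i) //= addnAC subnKC ?value_le //.
have -> : n * n = \sum_(j < n) n by rewrite sum_nat_const card_ord.
by rewrite [leqRHS](bigD1 i) //= leq_add2l leq_sum // => j _; apply: value_le.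
Qed.

Lemma rank_deficit2 r i j : i != j ->
  rank r + (n - value r i) + (n - value r j) <= n * n.
Proof.
move=> ij; have ji : j != i by rewrite eq_sym.
have -> : n * n = \sum_(k < n) n by rewrite sum_nat_const card_ord.
rewrite /rank (bigD1 i) //= (bigD1 j) //=.
rewrite [leqRHS](bigD1 i) //= [in leqRHS](bigD1 j) //=.
set S := (X in n + (n + X)); set T := (X in value r i + (value r j + X)).
have : T <= S by apply: leq_sum => k _; apply: value_le.
move: (value_le r i) (value_le r j) => vi vj TS.
have := leq_add (leqnn (n + n)) TS; lia.
Qed.

Lemma rank_le_sq r : rank r <= n * n.
Proof.
have -> : n * n = \sum_(k < n) n by rewrite sum_nat_const card_ord.
by apply: leq_sum => i _; apply: value_le.
Qed.

Lemma rank0_value r i : rank r = 0 -> value r i = 0.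
Proof. by move/eqP; rewrite sum_nat_eq0 => /forallP/(_ i)/eqP. Qed.

Lemma rank_ge2 r i j : i != j -> value r i + value r j <= rank r.
Proof.
move=> ij; rewrite /rank (bigD1 i) //= (bigD1 j) 1?eq_sym //=; lia.
Qed.

Lemma chain_rank_inj (C : {set tamariB n}) :
  is_chain C -> {in C &, injective rank}.
Proof.
move=> /forall_inP ch r s rC sC e.
have /forall_inP/(_ s sC)/orP[rs|sr] := ch r rC; first exact: rank_inj_le.
exact/esym/rank_inj_le.
Qed.

Lemma chain_le (C : {set tamariB n}) r s :
  is_chain C -> r \in C -> s \in C -> rank r <= rank s -> (r <= s)%O.
Proof.
move=> ch rC sC rs; move/forall_inP: (ch) => ch'.
have /forall_inP/(_ s sC)/orP[//|sr] := ch' r rC.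
by rewrite (rank_inj_le sr) //; apply/eqP; rewrite eqn_leq rs rank_le.
Qed.

Definition rank_ord r : 'I_(n * n).+1 := Ordinal (rank_le_sq r : rank r < (n * n).+1).

Lemma chain_card (C : {set tamariB n}) : is_chain C -> #|C| <= (n * n).+1.
Proof.
move=> ch; rewrite -[leqRHS]card_ord -(card_in_imset (f := rank_ord)).
  exact: max_card.
by move=> r s rC sC [] e; apply: (chain_rank_inj ch).
Qed.

(** * Elements of extreme rank *)

Hypothesis n_ge4 : 4 <= n.

(** A value [v < n] at [i] loses [n - v], and by rule 1 its left neighbour loses at least one more,
    so at least 3 in total; if [v = 0], where rule 1 is silent, the loss is already [n]. *)
Lemma top_rank_value r i : n * n - 2 <= rank r -> 0 < i -> value r i = n.
Proof.
move=> top i_gt0; apply/eqP; rewrite eqn_leq value_le leqNgt; apply/negP => vi.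
have ip : i.-1 < n by have := ltn_ord i; lia.
pose j := Ordinal ip; have ji : j < i by rewrite /=; lia.
have ne : i != j by apply: contraTneq ji => <-; rewrite ltnn.
have := rank_deficit1 r i; have := rank_deficit2 r ne.
have := value_rule1 ji vi; have nn : 16 <= n * n by nia.
rewrite /=; lia.
Qed.

Lemma extreme_rank_uniq r s :
  rank r = rank s -> (rank r == 0) || (n * n - 2 <= rank r) -> r = s.
Proof.
move=> e /orP[/eqP r0|top].
  by apply: value_inj => i; rewrite !rank0_value -?e.
have n0 : 0 < n by lia.
apply: (@rank_inj_off _ _ (Ordinal n0)) => // j j0.
have j_gt0 : 0 < j by rewrite lt0n; apply: contra j0 => /eqP j0; apply/eqP/val_inj.
by rewrite !top_rank_value // -e.
Qed.

Let n_gt0 : 0 < n. Proof. by lia. Qed.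

Definition last_pos : 'I_n := Ordinal (etrans (ltn_predL n) n_gt0).

(** If the last value is [v] with [2 <= v < n], rule 1 makes the coordinate two places to the left
    lose at least 3, hence 4 in total; for smaller [v] the last coordinate and its neighbour already
    lose more than 3. *)
Lemma last_value_sub3 r : rank r = n * n - 3 -> value r last_pos = n.
Proof.
move=> r3; apply/eqP; rewrite eqn_leq value_le leqNgt; apply/negP => vi.
have before k : 0 < k < n -> exists2 j : 'I_n, j < last_pos & last_pos - j = k.
  move=> k_n; have kp : n.-1 - k < n by lia.
  by exists (Ordinal kp); rewrite /=; lia.
have [|j jl jE] := before 1; first by lia.
have [|k kl kE] := before 2; first by lia.
have nej : last_pos != j by apply: contraTneq jl => <-; rewrite ltnn.
have nek : last_pos != k by apply: contraTneq kl => <-; rewrite ltnn.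
have := rank_deficit1 r last_pos.
have := rank_deficit2 r nej; have := rank_deficit2 r nek.
have := value_rule1 jl vi; have := value_rule1 kl vi.
rewrite jE kE; have nn : 16 <= n * n by nia.
lia.
Qed.

(* On a chain meeting every intermediate rank, the last coordinate grows by
   steps of at most 1, so it takes the value [last_pos - j]; rule 1 then
   forces the [j]-th coordinate to vanish. *)
Lemma full_chain_last_value (C : {set tamariB n}) r :
    is_chain C ->
    (forall l, 0 < l -> l + 3 <= n * n -> exists2 s, s \in C & rank s = l) ->
  r \in C -> rank r = 1 -> 0 < value r last_pos.
Proof.
move=> ch full rC r1; rewrite lt0n; apply/negP => /eqP last0.
have nn : 16 <= n * n by nia.
have [j rj] : exists j, 0 < value r j.
  apply/existsP; rewrite -[[exists _, _]]negbK negb_exists.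
  apply/negP => /forallP r0; have : rank r = 0; last by rewrite r1.
  apply/eqP; rewrite sum_nat_eq0; apply/forallP => i.
  by move: (r0 i); rewrite lt0n negbK.
have jl : j < last_pos.
  rewrite ltn_neqAle; apply/andP; split; last by have := ltn_ord j; rewrite /=; lia.
  by apply: contraTneq rj => /val_inj ->; rewrite last0.
have small l s : 0 < l -> l + 3 <= n * n -> s \in C -> rank s = l ->
    value s last_pos < last_pos - j.
  elim: l s => // l IHl s _ ln sC sl.
  have [l0|l_gt0] := posnP l.
    by rewrite (chain_rank_inj ch sC rC) ?last0 ?subn_gt0 // sl l0.
  have [|t tC tl] := full l l_gt0; first by lia.
  have := IHl t l_gt0 _ tC tl.
  have ts : (t <= s)%O by apply: (chain_le ch) => //; lia.
  have rs : (r <= s)%O by apply: (chain_le ch) => //; lia.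
  have := rank_step last_pos ts.
  have : value r j <= value s j by move: rs; rewrite le_value => /forallP.
  have := value_rule1 (r := s) jl; rewrite /=; lia.
(* At rank [n * n - 3] the last coordinate is [n], which violates the bound of [small]. *)
have [||s sC s3] := full (n * n - 3); try lia.
have := small _ s _ _ sC s3; rewrite last_value_sub3 //=; lia.
Qed.

(** * Counting two chains rank by rank *)

Definition rank_level (C : {set tamariB n}) l := [set r in C | rank r == l].

Lemma chain_rank_level (C : {set tamariB n}) (l : nat) :
  is_chain C -> #|rank_level C l| <= 1.
Proof.
move=> ch; apply/card_le1_eqP => r s; rewrite !inE.
move=> /andP[rC /eqP rl] /andP[sC /eqP sl].
by apply: (chain_rank_inj ch sC rC); rewrite rl.
Qed.

Lemma extreme_rank_level (C : {set tamariB n}) (l : nat) :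
  (l == 0) || (n * n - 2 <= l) -> #|rank_level C l| <= 1.
Proof.
move=> ex; apply/card_le1_eqP => r s; rewrite !inE.
move=> /andP[_ /eqP rl] /andP[_ /eqP sl].
by apply: extreme_rank_uniq; rewrite sl ?rl.
Qed.

(** The last coordinate uses up the whole rank. *)
Lemma rank1_uniq r s : rank r = 1 -> rank s = 1 ->
  0 < value r last_pos -> 0 < value s last_pos -> r = s.
Proof.
move=> r1 s1 rl sl; apply: (@rank_inj_off _ _ last_pos); last by rewrite r1.
move=> j jl; have := rank_ge2 r jl; have := rank_ge2 s jl; lia.
Qed.

Lemma card_rank_level (C : {set tamariB n}) :
  #|C| = \sum_(l < (n * n).+1) #|rank_level C l|.
Proof.
rewrite -sum1_card (partition_big rank_ord xpredT) //=.
apply: eq_bigr => l _; rewrite -sum1_card.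
by apply: eq_bigl => r; rewrite !inE -val_eqE.
Qed.

Lemma rank_levelU (C D : {set tamariB n}) l :
  rank_level (C :|: D) l = rank_level C l :|: rank_level D l.
Proof. by apply/setP => r; rewrite !inE andb_orl. Qed.

Lemma two_chains_rank_gap (C D : {set tamariB n}) :
    is_chain C -> is_chain D ->
  exists l, [&& 0 < l, l + 3 <= n * n & #|rank_level (C :|: D) l| <= 1].
Proof.
move=> chC chD; pose gap l := [&& 0 < l, l + 3 <= n * n
  & #|rank_level (C :|: D) l| <= 1].
have [/existsP[l lgap]|] := boolP [exists l : 'I_(n * n).+1, gap l].
  by exists l.
rewrite negb_exists => /forallP nogap; exfalso.
have nn : 16 <= n * n by nia.
have two l : 0 < l -> l + 3 <= n * n -> 1 < #|rank_level (C :|: D) l|.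
  move=> l0 ln; have lN : l < (n * n).+1 by lia.
  by have := nogap (Ordinal lN); rewrite /gap /= l0 ln /= -ltnNge.
(* The other chain contributes at most one element to a level, so a level with two elements also
   meets [E]. *)
have full E l : is_chain E -> 1 < #|rank_level C l :|: rank_level D l| ->
    #|rank_level C l :|: rank_level D l| <= #|rank_level E l| + 1 ->
    exists2 s, s \in E & rank s = l.
  move=> chE l2 lE; have : 0 < #|rank_level E l| by lia.
  by case/card_gt0P => s; rewrite inE => /andP[sE /eqP]; exists s.
have fullC l : 0 < l -> l + 3 <= n * n -> exists2 s, s \in C & rank s = l.
  move=> l0 ln; have := two l l0 ln; rewrite rank_levelU => l2; apply: full => //.
  by rewrite (leq_trans (leq_card_setU _ _).1) // leq_add2l chain_rank_level.
have fullD l : 0 < l -> l + 3 <= n * n -> exists2 s, s \in D & rank s = l.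
  move=> l0 ln; have := two l l0 ln; rewrite rank_levelU => l2; apply: full => //.
  by rewrite (leq_trans (leq_card_setU _ _).1) // addnC leq_add2l chain_rank_level.
have /card_gt1P[r [s [rCD sCD /eqP[]]]] : 1 < #|rank_level (C :|: D) 1|.
  by apply: two; lia.
have last_gt0 t : t \in rank_level (C :|: D) 1 ->
    rank t = 1 /\ 0 < value t last_pos.
  rewrite !inE => /andP[/orP[tC|tD] /eqP t1]; split=> //.
    exact: full_chain_last_value chC fullC tC t1.
  exact: full_chain_last_value chD fullD tD t1.
have [r1 rl] := last_gt0 r rCD; have [s1 sl] := last_gt0 s sCD.
exact: rank1_uniq.
Qed.

Lemma two_chains_card (C D : {set tamariB n}) :
  is_chain C -> is_chain D -> #|C :|: D| + 3 <= 2 * (n * n).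
Proof.
move=> chC chD; have [l0 /and3P[l0_gt0 l0n l0gap]] := two_chains_rank_gap chC chD.
have nn : 16 <= n * n by nia.
set N := n * n in nn l0n *.
(* Five levels hold at most one element and the others at most two:
   [2 * (N + 1) - 5 = 2 * N - 3]. *)
pose S := [set l : 'I_N.+1 | [|| l == 0 :> nat, N - 2 <= l | l == l0 :> nat]].
have S5 : 4 < #|S|.
  apply/card_geqP; exists [seq inord l | l <- [:: 0; l0; N - 2; N - 1; N]].
  have inN l : l \in [:: 0; l0; N - 2; N - 1; N] -> l < N.+1.
    by rewrite !inE; lia.
  split=> //.
    rewrite map_inj_in_uniq; first by rewrite /= !inE; lia.
    by move=> k l /inN kN /inN lN /(congr1 val); rewrite /= !inordK.
  by move=> _ /mapP[l lN ->]; rewrite inE inordK ?inN //; move: lN; rewrite !inE; lia.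
have : #|C :|: D| + #|S| <= \sum_(l < N.+1) 2.
  rewrite card_rank_level -sum1_card [\sum_(l in S) 1]big_mkcond -big_split /=.
  apply: leq_sum => l _; case: ifP => [|_].
    rewrite inE orbA => /orP[ex|/eqP ->]; last by rewrite addn1 ltnS.
    by rewrite addn1 ltnS extreme_rank_level.
  rewrite addn0 rank_levelU (leq_trans (leq_card_setU _ _).1) //.
  by apply: (@leq_add _ _ 1 1); apply: chain_rank_level.
rewrite sum_nat_const card_ord; lia.
Qed.

End Values.

(** * Elements and chains given by words *)

Section Words.
Variable n : nat.
Implicit Types (g : nat -> nat).

(* The defining rules of [tamariB] on 0-based natural positions, with [n]
   standing for infinity. *)
Definition tamariB_word g : Prop :=
  [/\ forall i, i < n -> g i <= n,
      forall i j, i < j -> j < n -> g j < n -> j - i <= g j ->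
        g i <= g j - (j - i)
    & forall i j, i < n -> j < n -> g i < n -> i < g i ->
        j.+1 = n + i.+1 - g i -> g j = n].

Lemma tamariB_of_word g :
  tamariB_word g -> {r : tamariB n | forall i : 'I_n, value r i = g i}.
Proof.
(* [insub] yields [None], that is infinity, when [g i] is not below [n]. *)
move=> [g_le g1 g2]; pose r := [ffun i : 'I_n => insub (g i) : symbol n].
have rE (i : 'I_n) : oapp val n (r i) = g i.
  rewrite ffunE; case: insubP => [a _ /= ->|] /=; first by [].
  by rewrite -leqNgt => ng; apply/eqP; rewrite eqn_leq ng g_le.
suff P : tamariB_rule1 r && tamariB_rule2 r.
  by exists (TamariB P) => i; rewrite -rE.
apply/andP; split; apply/forallP => i.
  apply/forallP => j; apply/implyP => ij.
  have := rE i; have := rE j; case: (r j) => // b /= bE iE.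
  apply/implyP => jb; have b_lt := ltn_ord b.
  have := g1 i j ij (ltn_ord j); rewrite -bE => /(_ b_lt jb); rewrite -iE.
  by case: (r i) => //= a; lia.
have := rE i; case: (r i) => // a /= aE; apply/implyP => ia.
apply/forallP => j; apply/implyP => /eqP ja.
have := g2 i j (ltn_ord i) (ltn_ord j); rewrite -aE => /(_ (ltn_ord a) ia ja).
rewrite -rE; case: (r j) => //= b bE.
by have := ltn_ord b; rewrite bE ltnn.
Qed.

(** The last clause keeps the words, from which disjointness of two chains can be read off. *)
Lemma chain_of_words m (g : nat -> nat -> nat) :
    (forall l, l < m -> tamariB_word (g l)) ->
    (forall l l', l < l' -> l' < m -> forall k, k < n -> g l k <= g l' k) ->
    (forall l l', l < l' -> l' < m -> exists2 k, k < n & g l k < g l' k) ->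
  exists C : {set tamariB n}, [/\ is_chain C, #|C| = m
    & forall r, r \in C ->
        exists2 l, l < m & forall i : 'I_n, value r i = g l i].
Proof.
move=> wg mono strict.
pose t (l : 'I_m) := sval (tamariB_of_word (wg l (ltn_ord l))).
have tE l i : value (t l) i = g l i by rewrite /t; case: tamariB_of_word.
have t_le (l l' : 'I_m) : l <= l' -> (t l <= t l')%O.
  rewrite leq_eqVlt => /orP[/eqP/val_inj -> //|ll'].
  by rewrite le_value; apply/forallP => i; rewrite !tE mono.
have t_inj : injective t.
  move=> l l' e; apply/val_inj/eqP; rewrite eqn_leq.
  have no (k k' : 'I_m) : t k = t k' -> k <= k'.
    move=> ekk'; rewrite leqNgt; apply/negP => k'k.
    have [i i_n] := strict k' k k'k (ltn_ord k).
    by rewrite -(tE k (Ordinal i_n)) -(tE k' (Ordinal i_n)) ekk' ltnn.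
  by rewrite !no.
exists [set t l | l : 'I_m]; split.
- apply/forall_inP => _ /imsetP[l _ ->]; apply/forall_inP => _ /imsetP[l' _ ->].
  by apply/orP; case: (leqP l l') => [|/ltnW] /t_le; [left|right].
- by rewrite card_imset // card_ord.
- by move=> _ /imsetP[l _ ->]; exists l.
Qed.

(** * The two explicit chains *)

Hypothesis n_ge4 : 4 <= n.

(** Position [k] starts filling once the [n.-1 - k] positions to its right are full; until then the
    truncated subtraction gives 0. *)
Definition fill_word l k := minn n (l - n * (n.-1 - k)).

(* For [m > 0] the word of level [l = n * m + s] is
   [0 ... 0 [s >= n-2] min(n-2,s+1) (n-1 or n) n ... n] with the third
   displayed value at position [n - m], and equal to [n] only if [s = n - 1]. *)
Definition pair_word m s k :=
  if m is 0 then if k + 2 < n then 0 else if k + 2 == n then 1 else s.-1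
  else if k + m + 2 < n then 0
  else if k + m + 2 == n then nat_of_bool (n - 2 <= s)
  else if k + m + 1 == n then minn (n - 2) s.+1
  else if k + m == n then if s == n.-1 then n else n.-1
  else n.

(** Position [k] starts filling at least [n] levels before [j]. *)
Lemma fill_word_gt0 l j k :
  j < k -> k < n -> 0 < fill_word l j -> fill_word l k = n.
Proof.
rewrite /fill_word => jk kn.
have -> : n.-1 - j = (n.-1 - k) + (k - j) by lia.
rewrite mulnDr; have : n <= n * (k - j) by rewrite leq_pmulr // subn_gt0.
lia.
Qed.

(** Everything left of a finite entry is 0, which settles rule 1; rule 2 concerns a position to the
    right of a positive entry, which is full. *)
Lemma fill_word_tamariB l : tamariB_word (fill_word l).
Proof.
split=> [i _|i j ij jn jl _|i j i_n jn iN il jE]; first exact: geq_minl.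
  have : fill_word l i = 0; last by lia.
  apply/eqP; rewrite -leqn0 leqNgt; apply/negP => /(fill_word_gt0 ij jn).
  by move=> jN; rewrite jN ltnn in jl.
have [ij|ji] := ltnP i j; first exact: fill_word_gt0 (leq_ltn_trans _ il).
by lia.
Qed.

(** The cap [n - 2] is what rule 1 allows just before [n - 1], and the entry 1 before it fits since
    [n >= 4]. For [m = 0] the word ends in [1, s - 1], so [s = 2] would break rule 1. *)
Lemma pair_word_tamariB m s :
  s < n -> m < n -> (m = 0 -> 0 < s /\ s != 2) -> (m = n.-1 -> s + 3 <= n) ->
  tamariB_word (pair_word m s).
Proof.
move=> sn mn m0 mN; split.
- by move=> i _; rewrite /pair_word; case: m mn m0 mN => [|m] mn m0 mN; repeat case: ifP; lia.
- move=> i j ij jn; rewrite /pair_word.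
  by case: m mn m0 mN => [|m] mn m0 mN; repeat case: ifP; lia.
- move=> i j i_n jn; rewrite /pair_word.
  by case: m mn m0 mN => [|m] mn m0 mN; repeat case: ifP; lia.
Qed.

Lemma fill_word_le l l' k : l <= l' -> fill_word l k <= fill_word l' k.
Proof. by rewrite /fill_word; lia. Qed.

Lemma fill_word_lt l l' : l < l' -> l' <= n * n ->
  exists2 k, k < n & fill_word l k < fill_word l' k.
Proof.
move=> ll' l'n; have n0 : 0 < n by lia.
have l_div : l %/ n < n by rewrite ltn_divLR // (leq_trans ll').
have := ltn_pmod l n0; have := divn_eq l n.
move: (l %/ n) (l %% n) l_div => q r qn lE rn.
(* At level [l], [q] coordinates are full and the next one to the left is being filled. *)
exists (n.-1 - q); rewrite ?/fill_word; first by lia.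
have -> : n.-1 - (n.-1 - q) = q by lia.
rewrite mulnC; lia.
Qed.

Lemma pair_word_le m s m' s' k :
    s < n -> s' < n -> (m = 0 -> 0 < s) -> k < n ->
  m < m' \/ m = m' /\ s < s' -> pair_word m s k <= pair_word m' s' k.
Proof.
move=> sn s'n m0 kn lt; rewrite /pair_word.
by case: m m0 lt => [|m] m0 lt; case: m' lt => [|m'] lt; repeat case: ifP; lia.
Qed.

Lemma pair_word_lt m s m' s' :
    s < n -> s' < n -> m' < n -> (m = 0 -> 0 < s) -> (m' = n.-1 -> s' + 3 <= n) ->
    m < m' \/ m = m' /\ s < s' ->
  exists2 k, k < n & pair_word m s k < pair_word m' s' k.
Proof.
move=> sn s'n m'n m0 m'N lt.
(* For [s < n - 3] the entry at [n - m - 1] is below its cap and still grows. *)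
have [sm|sm] := ltnP s (n - 3).
  exists (n - m - 1); first by lia.
  rewrite /pair_word.
  by case: m m0 lt => [|m] m0 lt; case: m' lt m'n m'N => [|m'] lt m'n m'N;
    repeat case: ifP; lia.
(* When [m] increases, this entry passes from at most [n - 2] to at least [n - 1]. *)
have [mm|mm] := ltnP m m'.
  exists (n - m - 1); first by lia.
  rewrite /pair_word.
  by case: m m0 lt mm => [|m] m0 lt mm; case: m' lt mm m'n m'N => [|m'] lt mm m'n m'N;
    repeat case: ifP; lia.
(* With [m] fixed and positive, [s = n - 3] is followed by the jump from 0 to 1 at [n - m - 2], and
   [s = n - 2] by the jump from [n - 1] to [n] at [n - m]. *)
exists (if m is 0 then n - 1 else if s == n - 3 then n - m - 2 else n - m).
  by case: m m0 lt mm => [|m]; repeat case: ifP; lia.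
rewrite /pair_word.
by case: m m0 lt mm => [|m] m0 lt mm; case: m' lt mm m'n m'N => [|m'] lt mm m'n m'N;
  repeat case: ifP; lia.
Qed.

(* Rank 2 is skipped since (0, ..., 0, 1, 1) violates the first rule. *)
Definition pair_level e := if e is 0 then 1 else e + 2.

Lemma max_chain_pair : exists C D : {set tamariB n},
  [/\ is_chain C, is_chain D, #|C| = (n * n).+1, #|D| = n * n - 4
    & [disjoint C & D]].
Proof.
have n0 : 0 < n by lia.
have [|l l' ll' l'N k _|l l' ll' l'N|C [chC cardC CE]] :=
  @chain_of_words (n * n).+1 fill_word.
- by move=> l _; apply: fill_word_tamariB.
- by apply: fill_word_le; apply: ltnW.
- exact: fill_word_lt.
pose g e := pair_word (pair_level e %/ n) (pair_level e %% n).
have lE e := divn_eq (pair_level e) n.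
have l_mod e : pair_level e %% n < n by apply: ltn_pmod.
have l0 e : pair_level e %/ n = 0 -> 0 < pair_level e %% n /\ pair_level e %% n != 2.
  by have := lE e => + m0; rewrite m0 mul0n add0n => <-; case: e {m0} => [|e] /=; lia.
have l_div e : e < n * n - 4 -> pair_level e %/ n < n.
  by move=> eN; rewrite ltn_divLR //; case: e eN => [|e] /=; nia.
have lN e : e < n * n - 4 -> pair_level e %/ n = n.-1 -> pair_level e %% n + 3 <= n.
  move=> eN mN; have := lE e; rewrite mN; have : pair_level e <= n * n - 3.
    by case: e {mN} eN => [|e] /=; nia.
  nia.
have lex e e' : e < e' -> pair_level e %/ n < pair_level e' %/ n \/
    pair_level e %/ n = pair_level e' %/ n /\ pair_level e %% n < pair_level e' %% n.
  move=> ee'; have le : pair_level e < pair_level e'.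
    by case: e e' ee' => [|e] [|e'] //=; lia.
  have := leq_div2r n (ltnW le); rewrite leq_eqVlt => /orP[/eqP em|]; last by left.
  by right; split=> //; have := lE e; have := lE e'; rewrite em; lia.
have [e eN|e e' ee' _ k kn|e e' ee' e'N|D [chD cardD DE]] :=
  @chain_of_words (n * n - 4) g.
- by apply: pair_word_tamariB; auto.
- by apply: pair_word_le; auto => /l0[].
- by apply: pair_word_lt; auto => /l0[].
exists C, D; split=> //.
apply/pred0P => r /=; apply/negP => /andP[/CE[l _ rl] /DE[e eN re]].
(* Every word of the second chain has a positive entry left of a finite one, contrary to
   [fill_word_gt0]. *)
have [j [k [jk kn]]] : exists j k, [/\ j < k, k < n, 0 < g e j & g e k < n].
  have := l_mod e; have := l_div e eN; have := l0 e; have := lN e eN; rewrite /g.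
  move: (pair_level e %/ n) (pair_level e %% n) => m s mN m0 mn sn.
  case: m mN m0 mn => [|m] mN m0 mn.
    by exists (n - 2), (n - 1); split; rewrite /pair_word; repeat case: ifP; lia.
  have [sm|sm] := ltnP s (n - 2).
    by exists (n - m.+2), (n - m.+1); split; rewrite /pair_word; repeat case: ifP; lia.
  by exists (n - m.+3), (n - m.+2); split; rewrite /pair_word; repeat case: ifP; lia.
have jn := ltn_trans jk kn.
rewrite -(re (Ordinal jn)) -(re (Ordinal kn)) !rl /=.
by move=> /(fill_word_gt0 jk kn) ->; rewrite ltnn.
Qed.

End Words.

(** * Maxima over one and two chains *)

Section ChainUnions.
Variables (d : Order.disp_t) (P : finPOrderType d).

Lemma max_chain_union1_le m :
  (forall C : {set P}, is_chain C -> #|C| <= m) -> max_chain_union P 1 <= m.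
Proof.
move=> Cm; apply/bigmax_leqP => C /forallP chC.
by rewrite big_ord_recl big_ord0 setU0; apply: Cm.
Qed.

Lemma max_chain_union2_le m :
  (forall C D : {set P}, is_chain C -> is_chain D -> #|C :|: D| <= m) ->
  max_chain_union P 2 <= m.
Proof.
move=> CDm; apply/bigmax_leqP => C /forallP chC.
by rewrite !big_ord_recl big_ord0 setU0; apply: CDm.
Qed.

Lemma chain_card_le (C : {set P}) : is_chain C -> #|C| <= max_chain_union P 1.
Proof.
move=> chC; pose F := [ffun _ : 'I_1 => C].
have chF : [forall i, is_chain (F i)] by apply/forallP => i; rewrite ffunE.
apply: leq_trans (leq_bigmax_cond _ chF).
by rewrite big_ord_recl big_ord0 setU0 ffunE.
Qed.

Lemma chains_card_le (C D : {set P}) :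
  is_chain C -> is_chain D -> #|C :|: D| <= max_chain_union P 2.
Proof.
move=> chC chD; pose F := [ffun i : 'I_2 => if i == ord0 then C else D].
have chF : [forall i, is_chain (F i)].
  by apply/forallP => i; rewrite ffunE; case: ifP.
apply: leq_trans (leq_bigmax_cond _ chF).
by rewrite !big_ord_recl big_ord0 setU0 !ffunE.
Qed.

End ChainUnions.

Theorem theorem1 (n : nat) (n_ge4 : (4 <= n)%N) :
  ((greene_kleitman (tamariB n) 2)%:Z =
     (greene_kleitman (tamariB n) 1)%:Z - 5%:Z)%R.
Proof.
have [C [D [chC chD cardC cardD disCD]]] := max_chain_pair n_ge4.
have nn : 16 <= n * n by nia.
have one : max_chain_union (tamariB n) 1 = (n * n).+1.
  apply/eqP; rewrite eqn_leq -{2}cardC chain_card_le // andbT.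
  by apply: max_chain_union1_le => E; apply: chain_card.
have two : max_chain_union (tamariB n) 2 = 2 * (n * n) - 3.
  apply/eqP; rewrite eqn_leq max_chain_union2_le => [|E F chE chF].
    apply: leq_trans (chains_card_le chC chD); rewrite cardsU.
    by move: disCD; rewrite -setI_eq0 => /eqP ->; rewrite cards0 cardC cardD; lia.
  by rewrite -(leq_add2r 3) (leq_trans (two_chains_card n_ge4 chE chF)) //; lia.
(* The two parts are [n * n + 1] and [(2 * (n * n) - 3) - (n * n + 1) = n * n - 4]. *)
rewrite /greene_kleitman two one max_chain_union0; lia.
Qed.
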